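(* Let $\mathfrak g$ be a real 2-step nilpotent Lie algebra with $\dim([\mathfrak g,\mathfrak g])=n$, and let $V$ be a vector space complement to $[\mathfrak g,\mathfrak g]$ in $\mathfrak g$, $\dim V=m$. Let $v_1,\dots,v_m$ be a basis of $V$, let $z_1,\dots,z_n$ be a basis of $[\mathfrak g,\mathfrak g]$, and let $C^1,\dots,C^n\in\mathfrak{so}(m)$ be the skew-symmetric matrices determined by $[v_i,v_j]=\sum_{k=1}^n C^k_{ij}z_k$. Let $p,q\ge 0$ be integers with $p+q=m$. Then there is an $n$-dimensional subspace $\mathcal D$ of $\mathfrak{so}(p,q)$ (so $n\le \frac{m(m-1)}{2}$), namely $\mathcal D=\mathrm{span}_{\mathbb R}\{C^1\eta_{p,q},\dots,C^n\eta_{p,q}\}$, such that if $\mathcal D$ is a non-degenerate subspace of $(\mathfrak{so}(p,q),\langle\cdot,\cdot\rangle_{\mathfrak{so}(p,q)})$, then $\mathfrak g$ is isomorphic as a Lie algebra to the standard pseudo-metric 2-step nilpotent Lie algebra $\mathcal G=\mathbb R^{p,q}\oplus_{\perp}\mathcal D$.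
   Context: All Lie algebras are real and finite dimensional. $\eta_{p,q}=\mathrm{diag}(I_p,-I_q)$; $\mathbb R^{p,q}$ is $\mathbb R^{p+q}$ with $\langle x,y\rangle_{p,q}=x^{\mathbf t}\eta_{p,q}y$. $\mathfrak{so}(p,q)$ is the Lie algebra of $(m\times m)$ real matrices $A$, $m=p+q$, with $\eta_{p,q}A^{\mathbf t}\eta_{p,q}=-A$, equipped with the (possibly indefinite) scalar product $\langle A,B\rangle_{\mathfrak{so}(p,q)}=-\mathrm{tr}(AB)$. A subspace is non-degenerate if the restriction of the scalar product to it is non-degenerate. For a non-degenerate subspace $W\subset\mathfrak{so}(p,q)$, the standard pseudo-metric 2-step nilpotent Lie algebra $\mathbb R^{p,q}\oplus_\perp W$ is the orthogonal direct sum with scalar product $\langle\cdot,\cdot\rangle_{p,q}+\langle\cdot,\cdot\rangle_{\mathfrak{so}(p,q)}$ and Lie bracket such that $W$ lies in the centre and, for $x,y\in\mathbb R^{p,q}$, $[x,y]$ is the unique element of $W$ with $\langle [x,y],z\rangle_{\mathfrak{so}(p,q)}=\langle z(x),y\rangle_{p,q}$ for all $z\in W$. *)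

(* Defs.v *)
From HB Require Import structures.
From mathcomp Require Import all_boot all_order all_algebra.
From mathcomp Require Import boolp classical_sets reals.

Set Implicit Arguments.
Unset Strict Implicit.
Unset Printing Implicit Defensive.

Import Order.TTheory GRing.Theory Num.Theory.
Local Open Scope ring_scope.

HB.mixin Record Vector_isLieAlgebra (K : fieldType) g of Vector K g := {
  lie : g -> g -> g;
  lie_linearl : forall (a : K) (x y z : g),
    lie (a *: x + y) z = a *: lie x z + lie y z;
  lie_linearr : forall (a : K) (x y z : g),
    lie z (a *: x + y) = a *: lie z x + lie z y;
  liexx : forall x : g, lie x x = 0;
  lie_jacobi : forall x y z : g,
    lie x (lie y z) + lie y (lie z x) + lie z (lie x y) = 0
}.

(* Finite dimensionality comes from the Vector structure. *)
#[short(type="lieAlgType")]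
HB.structure Definition LieAlgebra (K : fieldType) :=
  {g of Vector K g & Vector_isLieAlgebra K g}.

Definition lie_isomorphic (K : fieldType) (g h : lieAlgType K) : Prop :=
  exists f : 'Hom(g, h),
    bijective f /\ forall x y, f (lie x y) = lie (f x) (f y).

Section LieProduct.
Variables (K : fieldType) (g : lieAlgType K).
Implicit Types U V W : {vspace g}.

(* [U, V], the span of all brackets of an element of U and one of V: by
   bilinearity bases suffice; see lie_prodP. *)
Definition lie_prod U V : {vspace g} :=
  <<[seq lie u v | u <- vbasis U, v <- vbasis V]>>%VS.

Lemma lie_suml (I : Type) (r : seq I) (c : I -> K) (u : I -> g) v :
  lie (\sum_(i <- r) c i *: u i) v = \sum_(i <- r) c i *: lie (u i) v.
Proof.
have lie0l : lie 0 v = 0 by have := lie_linearl (-1) v v v;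
  rewrite !scaleN1r !addNr.
by elim: r => [|i r IHr]; rewrite ?big_nil // !big_cons lie_linearl IHr.
Qed.

Lemma lie_sumr (I : Type) (r : seq I) (c : I -> K) (u : I -> g) v :
  lie v (\sum_(i <- r) c i *: u i) = \sum_(i <- r) c i *: lie v (u i).
Proof.
have lie0r : lie v 0 = 0 by have := lie_linearr (-1) v v v;
  rewrite !scaleN1r !addNr.
by elim: r => [|i r IHr]; rewrite ?big_nil // !big_cons lie_linearr IHr.
Qed.

Lemma lie_prodP U V W :
  reflect {in U & V, forall u v, lie u v \in W} (lie_prod U V <= W)%VS.
Proof.
apply: (iffP idP) => [sUVW u v /coord_vbasis -> /coord_vbasis -> | sUVW].
  rewrite lie_suml; apply: memv_suml => i _; rewrite memvZ //.
  rewrite lie_sumr; apply: memv_suml => j _; rewrite memvZ //.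
  rewrite (subvP sUVW) // memv_span //; apply/allpairsP.
  by exists ((vbasis U)`_i, (vbasis V)`_j); rewrite !memt_nth.
by apply/span_subvP => _ /allpairsP[[u v] /= [Uu Vv ->]];
  exact: sUVW (vbasis_mem Uu) (vbasis_mem Vv).
Qed.

Definition derived : {vspace g} := lie_prod fullv fullv.

(* [[g, g], g] = 0; abelian algebras are included. *)
Definition two_step_nilpotent : Prop := lie_prod derived fullv = 0%VS.

End LieProduct.

Arguments derived {K} g.
Arguments two_step_nilpotent {K} g.

Section PseudoOrthogonal.
Variables (R : realType) (p q : nat).
Local Notation M := 'M[R]_(p + q).

Definition eta_pq : M := block_mx 1%:M 0 0 (- 1%:M).

Definition scal_pq (x y : 'cV[R]_(p + q)) : R := (x^T *m eta_pq *m y) 0 0.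

Definition so_defect (A : M) : M := eta_pq *m A^T *m eta_pq + A.

Fact so_defect_is_linear : linear so_defect.
Proof.
move=> a A B; rewrite /so_defect linearP /= mulmxDr mulmxDl.
rewrite -scalemxAr -scalemxAl scalerDr.
by rewrite addrACA.
Qed.

HB.instance Definition _ :=
  GRing.isLinear.Build R M M *:%R so_defect so_defect_is_linear.

Definition so : {vspace M} := lker (linfun so_defect).

Lemma soP (A : M) : reflect (eta_pq *m A^T *m eta_pq = - A) (A \in so).
Proof. by rewrite memv_ker lfunE /= /so_defect addr_eq0; apply: eqP. Qed.

Definition so_scal (A B : M) : R := - \tr (A *m B).

Definition nondegenerate_so (W : {vspace M}) : Prop :=
  (W <= so)%VS /\
  forall A, A \in W -> (forall B, B \in W -> so_scal A B = 0) -> A = 0.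

Lemma so_scalDl a (A B C : M) :
  so_scal (a *: A + B) C = a * so_scal A C + so_scal B C.
Proof. by rewrite /so_scal mulmxDl -scalemxAl linearP /= opprD mulrN. Qed.

Lemma so_scalDr a (A B C : M) :
  so_scal C (a *: A + B) = a * so_scal C A + so_scal C B.
Proof. by rewrite /so_scal mulmxDr -scalemxAr linearP /= opprD mulrN. Qed.

Lemma scal_pqDl a x y z :
  scal_pq (a *: x + y) z = a * scal_pq x z + scal_pq y z.
Proof. by rewrite /scal_pq linearP /= !mulmxDl -!scalemxAl !mxE. Qed.

Lemma scal_pqDr a x y z :
  scal_pq z (a *: x + y) = a * scal_pq z x + scal_pq z y.
Proof. by rewrite /scal_pq mulmxDr -scalemxAr !mxE. Qed.

Lemma eta_pq_sq : eta_pq *m eta_pq = 1%:M.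
Proof.
rewrite /eta_pq mulmx_block !mulmx0 !mul0mx mulmxN mulNmx.
rewrite !mulmx1 opprK addr0 add0r.
by rewrite addr0 add0r -scalar_mx_block.
Qed.

Lemma tr_eta_pq : eta_pq^T = eta_pq.
Proof. by rewrite /eta_pq tr_block_mx !linear0 linearN /= !trmx1. Qed.

Lemma so_skew (A : M) x : A \in so -> scal_pq (A *m x) x = 0.
Proof.
move=> /soP soA; set c := scal_pq _ _.
suff cN : c = - c.
  by apply/eqP; rewrite -eqNr -cN.
have tr11 (B : 'M[R]_1) : B^T 0 0 = B 0 0 by rewrite mxE.
have etaA : A^T *m eta_pq = - (eta_pq *m A).
  by rewrite -[A^T]mul1mx -eta_pq_sq -!mulmxA (mulmxA eta_pq A^T) soA mulmxN.
rewrite {1}/c /scal_pq trmx_mul -(mulmxA x^T) etaA mulmxN mulNmx mxE.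
congr (- _).
by rewrite -tr11 /c /scal_pq !trmx_mul trmxK tr_eta_pq !mulmxA.
Qed.

Section Standard.
Variable W : {vspace M}.

(* [x, y] is the w in W with <w, z> = <z x, y> for all z in W; it exists and is
   unique when W is non-degenerate (std_bracket_xyP and std_bracket_xy_eq). *)
Definition std_bracket_xy (x y : 'cV[R]_(p + q)) : subvs_of W :=
  xget 0 (fun w : subvs_of W =>
    forall z, z \in W -> so_scal (vsval w) z = scal_pq (z *m x) y).

Hypothesis ndW : nondegenerate_so W.

Lemma std_bracket_xy_ex x y : exists w : subvs_of W,
  forall z, z \in W -> so_scal (vsval w) z = scal_pq (z *m x) y.
Proof.
pose b := vbasis W.
pose F (w : subvs_of W) : 'rV[R]_(\dim W) := \row_i so_scal (vsval w) b`_i.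
have linF : linear F.
  by move=> a u v; apply/rowP => i; rewrite !mxE linearP /= so_scalDl.
pose HF := GRing.isLinear.Build _ _ _ _ F linF.
pose FL : {linear subvs_of W -> 'rV[R]_(\dim W)} := HB.pack F HF.
pose f := linfun FL.
have sum0 A : so_scal A 0 = 0 by rewrite /so_scal mulmx0 mxtrace0 oppr0.
have ext A z : z \in W -> so_scal A z = \sum_i coord b i z * so_scal A b`_i.
  move=> /coord_vbasis {1}->; rewrite -/b.
  elim/big_rec2: _ => [|i s t _ IH]; first exact: sum0.
  by rewrite so_scalDr IH.
have kf : lker f = 0%VS.
  apply/eqP; rewrite -subv0; apply/subvP => w; rewrite memv_ker lfunE /= memv0.
  move=> /eqP Fw0; apply/eqP/val_inj; apply: ndW.2; first exact: subvsP.
  move=> B WB; rewrite ext //; apply: big1 => i _.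
  by have /rowP/(_ i) := Fw0; rewrite !mxE => ->; rewrite mulr0.
have full : limg f = fullv.
  apply/eqP; rewrite eqEdim subvf /= limg_dim_eq ?kf ?capv0 //.
  by rewrite !dimvf /dim /= mul1n.
pose r : 'rV[R]_(\dim W) := \row_i scal_pq (b`_i *m x) y.
have /memv_imgP[w _ rw] : r \in limg f by rewrite full memvf.
exists w => z Wz; rewrite ext //.
rewrite {2}(coord_vbasis Wz) -/b.
have wi (i : 'I_(\dim W)) : so_scal (vsval w) b`_i = scal_pq (b`_i *m x) y.
  by have /rowP/(_ i) := rw; rewrite lfunE !mxE.
elim/big_rec2: _ => [|i s t _ ->].
  by rewrite /scal_pq mul0mx trmx0 !mul0mx mxE.
by rewrite mulmxDl -scalemxAl scal_pqDl wi.
Qed.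

Lemma std_bracket_xyP x y z :
  z \in W -> so_scal (vsval (std_bracket_xy x y)) z = scal_pq (z *m x) y.
Proof. exact: (xgetPex 0 (std_bracket_xy_ex x y)). Qed.

Lemma std_bracket_xy_eq x y (w : subvs_of W) :
  (forall z, z \in W -> so_scal (vsval w) z = scal_pq (z *m x) y) ->
  std_bracket_xy x y = w.
Proof.
move=> wP; apply/eqP; rewrite -subr_eq0; apply/eqP/val_inj.
apply: ndW.2 => [|B WB]; first exact: subvsP.
rewrite linearB /= addrC -scaleN1r so_scalDl wP //.
by rewrite std_bracket_xyP // mulN1r addNr.
Qed.

End Standard.

(* ndW is unused in the carrier: it keys the Lie algebra instance, whose axioms
   need it. *)
Definition std_alg (W : {vspace M}) (ndW : nondegenerate_so W) : Type :=
  ('cV[R]_(p + q) * subvs_of W)%type.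

Section StandardLie.
Variables (W : {vspace M}) (ndW : nondegenerate_so W).
Local Notation G := (std_alg ndW).

HB.instance Definition _ := Vector.copy G ('cV[R]_(p + q) * subvs_of W)%type.

Definition std_scal (u v : G) : R :=
  scal_pq u.1 v.1 + so_scal (vsval u.2) (vsval v.2).

Definition std_lie (u v : G) : G := (0, std_bracket_xy W u.1 v.1).

Fact std_lie_linearl a (x y z : G) :
  std_lie (a *: x + y) z = a *: std_lie x z + std_lie y z.
Proof.
congr pair => /=; first by rewrite addr0 scaler0.
apply: (std_bracket_xy_eq ndW) => // A WA.
by rewrite linearP so_scalDl !std_bracket_xyP // mulmxDr -scalemxAr scal_pqDl.
Qed.

Fact std_lie_linearr a (x y z : G) :
  std_lie z (a *: x + y) = a *: std_lie z x + std_lie z y.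
Proof.
congr pair => /=; first by rewrite addr0 scaler0.
apply: (std_bracket_xy_eq ndW) => // A WA.
by rewrite linearP so_scalDl !std_bracket_xyP // scal_pqDr.
Qed.

Fact std_liexx (x : G) : std_lie x x = 0.
Proof.
congr pair; apply: (std_bracket_xy_eq ndW) => // A WA.
by rewrite so_skew ?(subvP ndW.1) // /so_scal mul0mx mxtrace0 oppr0.
Qed.

Fact std_lie_jacobi (x y z : G) :
  std_lie x (std_lie y z) + std_lie y (std_lie z x)
  + std_lie z (std_lie x y) = 0.
Proof.
suff c0 (u v w : G) : std_lie u (std_lie v w) = 0 by rewrite !c0 !addr0.
congr pair; apply: (std_bracket_xy_eq ndW) => // A WA /=.
by rewrite /scal_pq mulmx0 mxE /so_scal mul0mx mxtrace0 oppr0.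
Qed.

HB.instance Definition _ := Vector_isLieAlgebra.Build R G
  std_lie_linearl std_lie_linearr std_liexx std_lie_jacobi.

End StandardLie.

End PseudoOrthogonal.

Arguments eta_pq {R} p q.
Arguments so {R} p q.

(* Main.v *)
Require Import Defs.
From HB Require Import structures.
From mathcomp Require Import all_boot all_order all_algebra.
From mathcomp Require Import reals.

Set Implicit Arguments.
Unset Strict Implicit.
Unset Printing Implicit Defensive.

Import Order.TTheory GRing.Theory Num.Theory.
Local Open Scope ring_scope.

(** Write eta for eta_(p,q), m for p + q, and D for the span of the matrices
    C^k eta. Since eta is an involution, A |-> A eta carries skew-symmetric
    matrices into so(p,q) and preserves linear independence. The C^k are
    independent because a relation between them is a linear form killing every
    bracket of basis vectors of V, hence killing the derived algebra, whose
    basis is z (structure_matrices_independent). This gives dim D = n, and the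
    bound on n by counting strictly upper triangular entries (skew_family_leq).

    When D is non-degenerate, the standard bracket on R^(p,q) satisfies
      < [x, y], C^k eta > = < C^k eta x, y >_(p,q)
                          = - (eta x)^T C^k (eta y),
    so up to sign it has the structure matrices of g once x and y are twisted
    by eta (scal_pq_skew_eta). Hence
      h(x, w) = sum_i (eta x)_i v_i - sum_k < w, C^k eta > z_k
    is a morphism from the standard algebra to g (of_std_lie). It is injective:
    eta is invertible on the first component, and non-degeneracy of D means that
    w in D is determined by its products with the C^k eta (of_std_ker). Both
    sides have dimension m + n, so h is bijective and its inverse is the desired
    isomorphism. Working with h rather than its inverse avoids choosing a basis
    of D dual to the C^k eta. *)

(** * Brackets in 2-step nilpotent Lie algebras *)

Section TwoStep.
Variables (K : fieldType) (g : lieAlgType K).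

Lemma lieDl (x y w : g) : lie (x + y) w = lie x w + lie y w.
Proof. by rewrite -[x]scale1r lie_linearl !scale1r. Qed.

Lemma lieDr (x y w : g) : lie w (x + y) = lie w x + lie w y.
Proof. by rewrite -[x]scale1r lie_linearr !scale1r. Qed.

Lemma lieC (x y : g) : lie x y = - lie y x.
Proof.
have := liexx (x + y).
by rewrite lieDl !lieDr !liexx add0r addr0 => /eqP; rewrite addr_eq0 => /eqP.
Qed.

Hypothesis nil2 : two_step_nilpotent g.

Lemma lie_derivedl (s w : g) : s \in derived g -> lie s w = 0.
Proof.
move=> ds; apply/eqP; rewrite -memv0.
have /lie_prodP : (lie_prod (derived g) fullv <= 0)%VS by rewrite nil2.
by apply=> //; apply: memvf.
Qed.

Lemma lie_derivedr (s w : g) : s \in derived g -> lie w s = 0.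
Proof. by move=> ds; rewrite lieC lie_derivedl ?oppr0. Qed.

Lemma lie_mod_derived (x y s t : g) :
  s \in derived g -> t \in derived g -> lie (x + s) (y + t) = lie x y.
Proof.
by move=> ds dt; rewrite lieDl lieDr (lie_derivedl _ ds) (lie_derivedr _ dt) !addr0.
Qed.

(** The derived algebra is central, so the brackets of any complement generate
    it. *)
Lemma derived_sub_complement (V W : {vspace g}) m (v : m.-tuple g) :
  (V + derived g = fullv)%VS -> basis_of V v ->
  (forall i j, lie (tnth v i) (tnth v j) \in W) -> (derived g <= W)%VS.
Proof.
move=> full vV vW; apply/lie_prodP => x y _ _.
have /memv_addP[x1 Vx [x2 dx ->]] : x \in (V + derived g)%VS.
  by rewrite full memvf.
have /memv_addP[y1 Vy [y2 dy ->]] : y \in (V + derived g)%VS.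
  by rewrite full memvf.
rewrite lie_mod_derived // (coord_basis vV Vx) (coord_basis vV Vy) lie_suml.
apply: memv_suml => i _; rewrite memvZ // lie_sumr.
by apply: memv_suml => j _; rewrite memvZ // -!tnth_nth.
Qed.

End TwoStep.

Section StructureMatrices.
Variables (K : fieldType) (g : lieAlgType K) (m n : nat).
Variables (v : m.-tuple g) (z : n.-tuple g) (C : 'I_n -> 'M[K]_m).
Hypothesis lie_vv :
  forall i j, lie (tnth v i) (tnth v j) = \sum_(k < n) C k i j *: tnth z k.

Lemma lie_structure (a b : 'cV[K]_m) :
  lie (\sum_i a i 0 *: tnth v i) (\sum_j b j 0 *: tnth v j)
    = \sum_(k < n) (a^T *m C k *m b) 0 0 *: tnth z k.
Proof.
rewrite lie_suml.
under eq_bigr => i _ do rewrite lie_sumr scaler_sumr.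
under eq_bigr => i _ do under eq_bigr => j _ do
  rewrite lie_vv scalerA scaler_sumr.
rewrite exchange_big /=.
under eq_bigr => j _ do rewrite exchange_big /=.
rewrite exchange_big /=; apply: eq_bigr => k _.
rewrite mxE scaler_suml; apply: eq_bigr => j _.
rewrite mxE mulr_suml scaler_suml; apply: eq_bigr => i _.
by rewrite scalerA mxE mulrAC.
Qed.

(** A linear relation between the structure matrices is a linear form on the
    derived algebra killing every bracket of basis vectors, hence killing the
    derived algebra itself. *)
Lemma structure_matrices_independent (V : {vspace g}) :
  two_step_nilpotent g -> (V + derived g = fullv)%VS ->
  basis_of V v -> basis_of (derived g) z ->
  forall a : 'I_n -> K, \sum_k a k *: C k = 0 -> forall k, a k = 0.
Proof.
move=> nil2 full vV zD a aC0.
have zF := basis_free zD.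
have coordz k l : coord z k (tnth z l) = (l == k)%:R.
  by rewrite (tnth_nth 0) coord_free.
(* The linear form sending z_k to a k, extended to g by the total function
   coord z. *)
pose F (x : g) : K^o := \sum_k a k * coord z k x.
have linF : linear F.
  move=> c x y; rewrite /F scaler_sumr -big_split /=; apply: eq_bigr => k _.
  by rewrite linearP /= mulrDr mulrCA.
pose HF := GRing.isLinear.Build _ _ _ _ F linF.
pose FL : {linear g -> K^o} := HB.pack F HF.
pose phi := linfun FL.
have phiE x : phi x = \sum_k a k * coord z k x by rewrite lfunE.
have dphi : (derived g <= lker phi)%VS.
  apply: (derived_sub_complement nil2 full vV) => i j.
  rewrite memv_ker phiE lie_vv; apply/eqP.
  transitivity ((\sum_k a k *: C k) i j); last by rewrite aC0 mxE.
  rewrite summxE; apply: eq_bigr => k _; rewrite mxE linear_sum /=.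
  congr (_ * _); rewrite (bigD1 k) //= linearZ /= coordz eqxx mulr1.
  rewrite big1 ?addr0 // => l /negPf lk.
  by rewrite linearZ /= coordz lk mulr0.
move=> k; have : tnth z k \in lker phi.
  by rewrite (subvP dphi) // (basis_mem zD) // mem_tnth.
rewrite memv_ker phiE (bigD1 k) //= coordz eqxx mulr1 big1 ?addr0 => [/eqP //|].
by move=> l /negPf lk; rewrite coordz eq_sym lk mulr0.
Qed.

End StructureMatrices.

(** * Dimension of the space of skew-symmetric matrices *)

Lemma card_upper_pairs m :
  #|[set x : 'I_m * 'I_m | (x.1 < x.2)%N]| = (m * m.-1)./2.
Proof.
rewrite -bin2 -bin2_sum big_mkord cardsE -sum1_card.
rewrite -(pair_big_dep predT (fun i j : 'I_m => (i < j)%N) (fun _ _ => 1%N)) /=.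
rewrite (exchange_big_dep predT) //=; apply: eq_bigr => j _.
rewrite -(big_ord_widen _ (fun=> 1%N) (ltnW (ltn_ord j))).
by rewrite sum1_card card_ord.
Qed.

(** A skew-symmetric matrix vanishes as soon as its strictly upper triangular
    entries do, so listing those entries keeps the family independent, now in a
    space whose dimension is the number of pairs i < j. *)
Lemma skew_family_leq (R : numFieldType) m n (C : 'I_n -> 'M[R]_m) :
  (forall k, (C k)^T = - C k) ->
  (forall a : 'I_n -> R, \sum_k a k *: C k = 0 -> forall k, a k = 0) ->
  (n <= (m * m.-1)./2)%N.
Proof.
move=> skC freeC; rewrite -card_upper_pairs.
set P := [set x | _].
pose A : 'M[R]_(n, #|P|) :=
  \matrix_(k, s) C k (enum_val s).1 (enum_val s).2.
suff /eqP <- : row_free A by apply: rank_leq_col.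
apply: inj_row_free => a aA0; apply/rowP => k; rewrite mxE.
apply: (freeC (fun k => a 0 k)); set S := \sum_k _.
have skS : S^T = - S.
  rewrite /S linear_sum /= -sumrN; apply: eq_bigr => l _.
  by rewrite linearZ /= skC scalerN.
have Sji i j : S j i = - S i j.
  by have /matrixP/(_ i j) := skS; rewrite mxE => ->; rewrite mxE.
have up (i j : 'I_m) : (i < j)%N -> S i j = 0.
  move=> ij; have Pij : (i, j) \in P by rewrite inE.
  have /rowP/(_ (enum_rank_in Pij (i, j))) := aA0.
  rewrite !mxE => <-; rewrite summxE; apply: eq_bigr => l _.
  by rewrite !mxE enum_rankK_in.
apply/matrixP => i j; rewrite [RHS]mxE.
case: (ltngtP i j) => [/up // | /up ji | /val_inj <-].
  by rewrite Sji ji oppr0.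
by apply/eqP; rewrite -eqNr -Sji.
Qed.

(** * The matrices C eta in so(p,q) *)

Section SkewToSo.
Variables (R : realType) (p q : nat).
Local Notation M := 'M[R]_(p + q).
Local Notation eta := (eta_pq p q : M).

(** As eta is symmetric with eta^2 = 1, eta (A eta)^T eta = A^T eta, so that
    skewness of A is exactly the defining equation for A eta. *)
Lemma skew_mul_eta_so (A : M) : A^T = - A -> A *m eta \in so p q.
Proof.
move=> skA; apply/soP; rewrite trmx_mul tr_eta_pq skA.
by rewrite mulmxA eta_pq_sq mul1mx mulNmx.
Qed.

(** Twisting x and y by eta turns the form defining the standard bracket into
    the opposite of the alternating form of A. This is where the factor eta and
    the minus sign of the isomorphism come from. *)
Lemma scal_pq_skew_eta (A : M) (x y : 'cV_(p + q)) : A^T = - A ->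
  scal_pq (A *m eta *m x) y = - ((eta *m x)^T *m A *m (eta *m y)) 0 0.
Proof.
move=> skA; rewrite /scal_pq !trmx_mul tr_eta_pq skA.
by rewrite !mulmxA mulmxN !mulNmx [LHS]mxE.
Qed.

Lemma so_scal_span0 (X : seq M) (A : M) :
  (forall B, B \in X -> so_scal A B = 0) ->
  forall B, B \in <<X>>%VS -> so_scal A B = 0.
Proof.
move=> AX B; rewrite -[X]/(val (in_tuple X)) => /coord_span ->.
elim/big_rec: _ => [|i C _ IH]; first by rewrite /so_scal mulmx0 mxtrace0 oppr0.
by rewrite so_scalDr IH addr0 AX ?mulr0 // mem_nth.
Qed.

Variables (n : nat) (C : 'I_n -> M).
Hypothesis freeC :
  forall a : 'I_n -> R, \sum_k a k *: C k = 0 -> forall k, a k = 0.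

Lemma dim_span_mul_eta : \dim <<[seq C k *m eta | k : 'I_n]>>%VS = n.
Proof.
pose X := [tuple C k *m eta | k < n].
have freeX : free X.
  apply/freeP => a aX0; apply: freeC.
  suff S0 : (\sum_k a k *: C k) *m eta = 0.
    by rewrite -[LHS]mulmx1 -eta_pq_sq mulmxA S0 mul0mx.
  rewrite mulmx_suml -[RHS]aX0; apply: eq_bigr => k _.
  by rewrite -tnth_nth tnth_mktuple scalemxAl.
by rewrite -[LHS]/(\dim <<X>>) (eqP freeX) size_tuple.
Qed.

End SkewToSo.

(** * The isomorphism *)

(** Lets an isomorphism be given in the direction in which an explicit formula
    is available. *)
Lemma lie_isomorphic_inv (K : fieldType) (g h : lieAlgType K) (f : 'Hom(h, g)) :
  lker f = 0%VS -> \dim {: g} = \dim {: h} ->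
  (forall x y, f (lie x y) = lie (f x) (f y)) -> lie_isomorphic g h.
Proof.
move=> /eqP kf0 dim_gh fL; have fK := lker0_lfunK kf0.
have fVK : cancel f^-1%VF f.
  move=> x; apply: limg_lfunVK; suff -> : limg f = fullv by apply: memvf.
  by apply/eqP; rewrite eqEdim subvf limg_dim_eq ?dim_gh //= (eqP kf0) capv0.
exists f^-1%VF; split; first by exists f.
by move=> x y; apply: (can_inj fK); rewrite fL !fVK.
Qed.

Section Isomorphism.
Variables (R : realType) (g : lieAlgType R) (n p q : nat).
Variables (v : (p + q).-tuple g) (z : n.-tuple g) (C : 'I_n -> 'M[R]_(p + q)).
Local Notation eta := (eta_pq p q : 'M[R]_(p + q)).
Local Notation D := (<<[seq C k *m eta | k : 'I_n]>>%VS).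
Variable ndD : nondegenerate_so D.
Local Notation G := (std_alg ndD).

(** The second sum expands w in D along the basis dual to the C k *m eta, and
    replaces the dual vector of index k by - z_k. *)
Definition of_std (x : G) : g :=
  \sum_i (eta *m x.1) i 0 *: tnth v i
  - \sum_k so_scal (vsval x.2) (C k *m eta) *: tnth z k.

Fact of_std_linear : linear of_std.
Proof.
move=> a x y; rewrite /of_std scalerBr addrACA -opprD !scaler_sumr -!big_split.
congr (_ - _); apply: eq_bigr => i _ /=.
  by rewrite mulmxDr -scalemxAr !mxE scalerDl scalerA.
by rewrite so_scalDl scalerDl scalerA.
Qed.

HB.instance Definition _ :=
  GRing.isLinear.Build R G g *:%R of_std of_std_linear.

Variable V : {vspace g}.
Hypothesis nil2 : two_step_nilpotent g.
Hypothesis full : (V + derived g = fullv)%VS.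
Hypothesis direct : (V :&: derived g = 0)%VS.
Hypothesis vV : basis_of V v.
Hypothesis zD : basis_of (derived g) z.
Hypothesis skC : forall k, (C k)^T = - C k.
Hypothesis lie_vv :
  forall i j, lie (tnth v i) (tnth v j) = \sum_(k < n) C k i j *: tnth z k.

Lemma sum_basisV (a : 'I_(p + q) -> R) : \sum_i a i *: tnth v i \in V.
Proof. by apply: memv_suml => i _; rewrite memvZ // (basis_mem vV) ?mem_tnth. Qed.

Lemma sum_basis_derived (a : 'I_n -> R) : \sum_k a k *: tnth z k \in derived g.
Proof. by apply: memv_suml => i _; rewrite memvZ // (basis_mem zD) ?mem_tnth. Qed.

(** The two sums defining of_std lie in V and in the derived algebra, which
    meet trivially, so both vanish on the kernel. *)
Lemma of_std_ker : lker (linfun of_std) = 0%VS.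
Proof.
apply/eqP; rewrite -subv0; apply/subvP => x.
rewrite memv_ker lfunE memv0 /= subr_eq0 => /eqP eqVz.
have v0 : \sum_i (eta *m x.1) i 0 *: tnth v i = 0.
  apply/eqP; rewrite -memv0 -direct memv_cap sum_basisV /=.
  by rewrite eqVz sum_basis_derived.
have x1 : x.1 = 0.
  rewrite -[x.1]mul1mx -eta_pq_sq -mulmxA.
  suff -> : eta *m x.1 = 0 by rewrite mulmx0.
  apply/colP => i; rewrite [RHS]mxE.
  apply: (freeP (basis_free vV) (fun i => (eta *m x.1) i 0)).
  by rewrite -[RHS]v0; apply: eq_bigr => j _; rewrite -tnth_nth.
have x2 : x.2 = 0.
  apply/val_inj; apply: ndD.2; first exact: subvsP.
  apply: so_scal_span0 => _ /mapP[k _ ->].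
  apply: (freeP (basis_free zD) (fun k => so_scal (vsval x.2) (C k *m eta))).
  by rewrite -[RHS]v0 eqVz; apply: eq_bigr => j _; rewrite -tnth_nth.
by case: x x1 x2 {eqVz v0} => x1 x2 /= -> ->.
Qed.

(** The part of of_std x along the derived algebra is central, so both sides
    depend on x.1 and y.1 only. *)
Lemma of_std_lie x y : of_std (lie x y) = lie (of_std x) (of_std y).
Proof.
rewrite [RHS](lie_mod_derived nil2) ?memvN ?sum_basis_derived //.
rewrite (lie_structure lie_vv) /of_std /= mulmx0.
rewrite big1 => [|i _]; last by rewrite mxE scale0r.
rewrite sub0r -sumrN; apply: eq_bigr => k _; rewrite std_bracket_xyP //.
  by rewrite scal_pq_skew_eta // scaleNr opprK.
by rewrite memv_span //; apply/mapP; exists k; rewrite ?mem_enum.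
Qed.

Lemma dim_std_alg : \dim {: g} = \dim {: G}.
Proof.
have freeC := structure_matrices_independent lie_vv nil2 full vV zD.
rewrite -full dimv_disjoint_sum // (size_basis vV) (size_basis zD) dimvf.
(* Column vectors are matrices, of dimension (p + q) * 1. *)
by rewrite -[RHS]/((p + q) * 1 + \dim D)%N dim_span_mul_eta // muln1.
Qed.

Lemma std_alg_isomorphic : lie_isomorphic g G.
Proof.
apply: (lie_isomorphic_inv of_std_ker dim_std_alg) => x y.
by rewrite !lfunE; apply: of_std_lie.
Qed.

End Isomorphism.

Theorem theorem4 (R : realType) (g : lieAlgType R) (n p q : nat)
  (V : {vspace g}) (v : (p + q).-tuple g) (z : n.-tuple g)
  (C : 'I_n -> 'M[R]_(p + q)) :
  two_step_nilpotent g ->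
  \dim (derived g) = n ->
  (V + derived g = fullv)%VS -> (V :&: derived g = 0)%VS ->
  \dim V = (p + q)%N ->
  basis_of V v ->
  basis_of (derived g) z ->
  (forall k, (C k)^T = - C k) ->
  (forall i j, lie (tnth v i) (tnth v j) = \sum_(k < n) C k i j *: tnth z k) ->
  exists D : {vspace 'M[R]_(p + q)},
    [/\ D = <<[seq C k *m eta_pq p q | k : 'I_n]>>%VS,
        (D <= so p q)%VS,
        \dim D = n,
        (n <= ((p + q) * (p + q).-1)./2)%N
      & forall ndD : nondegenerate_so D, lie_isomorphic g (std_alg ndD)].
Proof.
move=> nil2 _ full direct _ vV zD skC lie_vv.
have freeC := structure_matrices_independent lie_vv nil2 full vV zD.
exists <<[seq C k *m eta_pq p q | k : 'I_n]>>%VS; split=> // [|||ndD].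
- by apply/span_subvP => _ /mapP[k _ ->]; apply: skew_mul_eta_so.
- exact: dim_span_mul_eta.
- exact: skew_family_leq skC freeC.
- exact: (std_alg_isomorphic ndD nil2 full direct vV zD skC lie_vv).
Qed.
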